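(* Let $X$ be a compact, metric and totally disconnected space and let $f \colon X \to X$ be continuous. If the topological entropy of $f$ is nonzero, or if $f$ is positively expansive and $X$ is infinite, then every $\lambda \in \mathbb{C}$ with $|\lambda| \neq 0, 1$ is an eigenvalue of $f_* \colon \check{H}_0(X;\mathbb{C}) \to \check{H}_0(X;\mathbb{C})$.
   Context: For a compact space $Z$, the Čech cohomology group $\check{H}^0(Z;\mathbb{C})$ is identified with the $\mathbb{C}$-vector space of all locally constant maps $\varphi \colon Z \to \mathbb{C}$, and the map $f^*$ induced by a continuous $f \colon Z \to Z$ is $\varphi \mapsto \varphi \circ f$. Čech homology is the dual vector space $\check{H}_0(Z;\mathbb{C}) = \mathrm{Hom}(\check{H}^0(Z;\mathbb{C}),\mathbb{C})$, and $f_*$ is the dual of $f^*$, i.e. $f_*(T) = T \circ f^*$. A continuous map $f$ of a metric space $(X,d)$ is positively expansive if there is $\epsilon>0$ such that for all $x \neq y$ in $X$ there is $n \geq 0$ with $d(f^n(x),f^n(y)) > \epsilon$. *)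

(* Defs.v *)
From HB Require Import structures.
From mathcomp Require Import all_boot all_order all_algebra finmap.
From mathcomp Require Import complex.
From mathcomp Require Import all_classical all_reals all_analysis.

Set Implicit Arguments.
Unset Strict Implicit.
Unset Printing Implicit Defensive.

Import Order.TTheory GRing.Theory Num.Theory.
Import numFieldNormedType.Exports.

Local Open Scope classical_set_scope.
Local Open Scope ring_scope.

(* [leigenvalue] of the library is restricted to finite-dimensional spaces. *)
Definition is_eigenvalue (K : fieldType) (V : lmodType K) (g : {linear V -> V})
  (a : K) : Prop := exists2 v : V, v != 0 & g v = a *: v.

Section algebraic_dual.
Context {K : fieldType}.
Implicit Types V W : lmodType K.

Definition linear_forms V : {pred V -> K^o} := fun T => `[< linear T >].

Lemma linear_forms_submod_closed V : submod_closed (@linear_forms V).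
Proof.
split=> [|a S T /asboolP linS /asboolP linT]; apply/asboolP => b u v.
  by rewrite /= scaler0 addr0.
have E w : (a *: S + T) w = a *: S w + T w by [].
rewrite !E linS linT !scalerDr !scalerA [b * a]mulrC -!addrA.
by congr (_ + _); rewrite addrCA.
Qed.

HB.instance Definition _ V :=
  GRing.isSubmodClosed.Build K (V -> K^o) (@linear_forms V)
    (@linear_forms_submod_closed V).

Record dual V := Dual {
  dual_fun :> V -> K^o;
  dual_funP : dual_fun \in @linear_forms V }.

HB.instance Definition _ V := [isSub for @dual_fun V].
HB.instance Definition _ V := [Choice of dual V by <:].
HB.instance Definition _ V := [SubChoice_isSubLmodule of dual V by <:].

Lemma dual_linear V (T : dual V) : linear (T : V -> K^o).
Proof. exact/asboolP/dual_funP. Qed.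

Lemma dual_map_subproof V W (g : {linear V -> W}) (T : dual W) :
  (T : W -> K^o) \o g \in @linear_forms V.
Proof. by apply/asboolP => a u v /=; rewrite linearP dual_linear. Qed.

Definition dual_map V W (g : {linear V -> W}) (T : dual W) : dual V :=
  Dual (dual_map_subproof g T).

Lemma dual_map_linear V W (g : {linear V -> W}) : linear (dual_map g).
Proof. by move=> a S T; exact/val_inj. Qed.

HB.instance Definition _ V W (g : {linear V -> W}) :=
  GRing.isLinear.Build K (dual W) (dual V) _ (dual_map g)
    (@dual_map_linear V W g).

End algebraic_dual.

Section cech_degree0.
Context {K : fieldType}.
Implicit Types X Y : topologicalType.

Definition locally_constant X (phi : X -> K^o) : Prop :=
  forall x : X, \forall y \near x, phi y = phi x.

Definition locally_constants X : {pred X -> K^o} :=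
  fun phi => `[< locally_constant phi >].

Lemma locally_constants_submod_closed X : submod_closed (@locally_constants X).
Proof.
split=> [|a u v /asboolP lu /asboolP lv]; apply/asboolP => x.
  exact: nearW.
by apply: filterS2 (lu x) (lv x) => y /= yu yv; congr (_ *: _ + _).
Qed.

HB.instance Definition _ X :=
  GRing.isSubmodClosed.Build K (X -> K^o) (@locally_constants X)
    (@locally_constants_submod_closed X).

Record cechH0 X := CechH0 {
  cechH0_fun :> X -> K^o;
  cechH0_funP : cechH0_fun \in @locally_constants X }.

HB.instance Definition _ X := [isSub for @cechH0_fun X].
HB.instance Definition _ X := [Choice of cechH0 X by <:].
HB.instance Definition _ X := [SubChoice_isSubLmodule of cechH0 X by <:].

Lemma cech_pullback_subproof X Y (f : X -> Y) (cf : continuous f) (phi : cechH0 Y) :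
  (phi : Y -> K^o) \o f \in @locally_constants X.
Proof.
apply/asboolP => x; have /asboolP lphi := cechH0_funP phi.
exact: cf (lphi (f x)).
Qed.

Definition cech_pullback X Y (f : X -> Y) (cf : continuous f) (phi : cechH0 Y) :
  cechH0 X := CechH0 (cech_pullback_subproof cf phi).

Lemma cech_pullback_linear X Y (f : X -> Y) (cf : continuous f) :
  linear (cech_pullback cf).
Proof. by move=> a u v; exact/val_inj. Qed.

HB.instance Definition _ X Y (f : X -> Y) (cf : continuous f) :=
  GRing.isLinear.Build K (cechH0 Y) (cechH0 X) _ (cech_pullback cf)
    (@cech_pullback_linear X Y f cf).

Definition cech_pushforward X Y (f : X -> Y) (cf : continuous f) :
  {linear dual (cechH0 X) -> dual (cechH0 Y)} := dual_map (cech_pullback cf).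

End cech_degree0.

Arguments cechH0 K X : clear implicits.

Section dynamics.
Context {R : realType} {X : metricType R}.

Definition positively_expansive (f : X -> X) : Prop :=
  exists2 eps : R, 0 < eps &
    forall x y : X, x <> y ->
      exists n : nat, eps < mdist (iter n f x) (iter n f y).

Definition bowen_dist (f : X -> X) (n : nat) (x y : X) : R :=
  \big[Order.max/0]_(i < n) mdist (iter i f x) (iter i f y).

Definition separated (f : X -> X) (n : nat) (eps : R) (A : {fset X}) : Prop :=
  {in A &, forall x y, x != y -> eps < bowen_dist f n x y}.

(* The logarithm of the maximal cardinality of an (n, eps)-separated set.  As
   [ln 0 = 0], this is 0 on the empty space, whose entropy is therefore 0. *)
Definition log_sep (f : X -> X) (n : nat) (eps : R) : \bar R :=
  ereal_sup [set (ln (#|` A|%:R : R))%:E | A in separated f n eps].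

Definition sep_growth (f : X -> X) (eps : R) : \bar R :=
  limn_esup (fun n => (n%:R^-1)%:E * log_sep f n eps)%E.

(* Bowen's definition; [sep_growth f] is nonincreasing in [eps], so that the
   limit always exists. *)
Definition topological_entropy (f : X -> X) : \bar R :=
  lim (sep_growth f eps @[eps --> 0^'+]).

End dynamics.

(* Main.v *)
Require Import Defs.
From mathcomp Require Import all_boot all_order all_algebra finmap.
From mathcomp Require Import complex.
From mathcomp Require Import all_classical all_reals all_analysis.
From mathcomp Require Import zify ring lra.
Import Order.TTheory GRing.Theory Num.Theory.
Import numFieldNormedType.Exports.
Local Open Scope classical_set_scope.
Local Open Scope ring_scope.

(** An eigenvector of the dual map for the eigenvalue [lambda] is a nonzero
    linear form vanishing on the range of [f^* - lambda], so it exists as soon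
    as [f^* - lambda] is not surjective on locally constant functions
    ([dual_map_eigenvalue]).  It remains to find a locally constant [psi] that
    is not of the form [phi o f - lambda phi].

    Write [X] as a union of finitely many small clopen sets and code the points
    by the sets that contain them ([fine_clopen_coding]).  Either hypothesis on
    [f] makes the number of code words of length [n] unbounded
    ([expansive_unbounded], [entropy_unbounded]).  By the argument of Morse and
    Hedlund, some long words then have two continuations, to the right as well
    as to the left ([forward_branching], [backward_branching]), and a limit
    along an ultrafilter yields two full orbits [x] and [y] in [X], indexed by
    the integers, whose codes agree at all negative times but not at time 0, or
    agree at all positive times but not at time 0 ([asymptotic_orbits]).

    For [|lambda| > 1] take the first kind, and for [psi] the indicator of a
    long word of [x] ending at time 0.  If [phi o f = lambda phi + psi], the
    differences [d k] of [phi] along the two orbits satisfy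
    [d (k + 1) = lambda d k + e k], where [e] vanishes at negative times,
    [e 0 = 1] and [|e| <= 1].  As [phi] takes finitely many values, [d] cannot
    decay geometrically to 0 in the past, so [d 0 = 0] and [d 1 = 1]; nor
    can [d] grow geometrically in the future, so it is bounded by
    [1 / (|lambda| - 1)], whatever [phi] is.  If the word does not come back
    for [J] steps in either orbit, then [d (J + 1) = lambda ^ J], which exceeds
    that bound for [J] large ([driven_contradiction]).  That the word can be
    chosen so that it does not come back early is a fact on sequences
    ([non_recurrent_word]).

    For [|lambda| < 1] the same argument applies after time reversal, which
    turns [lambda] into its inverse. *)

(** * Linear forms and the spectrum of a dual map *)

(** A subspace [W] containing [G] and maximal among those missing [psi] is a
    hyperplane complementary to the line of [psi]; the form is the coordinate
    along that line. *)
Lemma dual_annihilator {K : fieldType} {V : lmodType K} (G : set V) (psi : V) :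
  G 0 -> (forall a u v, G u -> G v -> G (a *: u + v)) -> ~ G psi ->
  exists2 T : dual V, T psi = 1 & forall v, G v -> T v = 0.
Proof.
move=> G0 Glin Npsi.
pose subspace (W : set V) := forall a u v, W u -> W v -> W (a *: u + v).
(* Subspaces are represented by sets whose union with [G] is a subspace, so that
   the empty chain has an upper bound. *)
have [|W [[Wlin WNpsi] maxW]] :=
    @Zorn_bigcup V (fun W => subspace (W `|` G) /\ ~ (W `|` G) psi).
  move=> F FP Ftot; split; last first.
    by case=> // -[W FW Wpsi]; have [_ []] := FP _ FW; left.
  move=> a u v [[W1 F1 W1u]|Gu] [[W2 F2 W2v]|Gv].
  - wlog: / exists W3, [/\ F W3, W1 `<=` W3 & W2 `<=` W3].
      apply; have [?|?] := Ftot _ _ F1 F2; [exists W2|exists W1]; split=> //.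
    move=> [W3 [F3 s1 s2]]; have [lin3 _] := FP _ F3.
    have [] := lin3 a u v; [by left; apply: s1|by left; apply: s2| |].
      by left; exists W3.
    by right.
  - have [lin1 _] := FP _ F1.
    have [] := lin1 a u v; [by left|by right| |]; [by left; exists W1|by right].
  - have [lin2 _] := FP _ F2.
    have [] := lin2 a u v; [by right|by left| |]; [by left; exists W2|by right].
  - by right; apply: Glin.
set H := W `|` G in Wlin WNpsi.
have H0 : H 0 by right.
have HZ a u : H u -> H (a *: u).
  by move=> Hu; rewrite -[a *: u]addr0; apply: Wlin.
have HD u v : H u -> H v -> H (u + v).
  by move=> Hu Hv; rewrite -[u]scale1r; apply: Wlin.
have coef v : exists c, H (v - c *: psi).
  have [Hv|NHv] := pselect (H v); first by exists 0; rewrite scale0r subr0.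
  pose W' := [set w | exists c u, H u /\ w = u + c *: v].
  have HW' : H `<=` W' by move=> u Hu; exists 0, u; rewrite scale0r addr0.
  have W'G : W' `|` G = W'.
    by apply/seteqP; split=> [x []//Gx|x]; [apply: HW'; right|left].
  have ltWW' : W `<` W'.
    split; first by move=> x Wx; apply: HW'; left.
    move=> /(_ v) W'W; apply: NHv; left; apply: W'W.
    by exists 1, 0; rewrite scale1r add0r.
  have /not_andP[] := maxW _ ltWW'; rewrite W'G.
    case=> a x y [c [u [Hu ->]]] [c' [u' [Hu' ->]]].
    exists (a * c + c'), (a *: u + u'); split; first exact: Wlin.
    by rewrite scalerDr scalerA scalerDl addrACA.
  move=> /contrapT[c [u [Hu psiE]]].
  have c0 : c != 0.
    by apply/eqP => c0; apply: WNpsi; rewrite psiE c0 scale0r addr0.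
  exists c^-1; rewrite psiE scalerDr scalerA mulVf // scale1r.
  by rewrite opprD addrCA subrr addr0 -scaleN1r; apply/HZ/HZ.
have coef_uniq v c c' : H (v - c *: psi) -> H (v - c' *: psi) -> c = c'.
  move=> Hc Hc'; apply: contrapT => /eqP; rewrite -subr_eq0 => cc'.
  apply: WNpsi.
  have -> : psi = (c' - c)^-1 *: ((v - c *: psi) - (v - c' *: psi)).
    rewrite opprB [X in _ *: X]addrC addrA subrK -scalerBl scalerA.
    rewrite mulVf ?scale1r //.
    by rewrite -oppr_eq0 opprB.
  by apply/HZ/HD => //; rewrite -scaleN1r; apply: HZ.
pose T v := sval (cid (coef v)).
have TP v : H (v - T v *: psi) by rewrite /T; case: cid.
have Tlin : linear (T : V -> K^o).
  move=> a u v; apply: (coef_uniq (a *: u + v)) => //.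
  rewrite scalerDl opprD addrACA -[_ *: psi]scalerA -scalerBr.
  by apply: Wlin.
exists (Dual (introT (asboolP _) Tlin)) => [|v Gv] /=.
  by apply: (coef_uniq psi) => //; rewrite scale1r subrr.
by apply: (coef_uniq v) => //; rewrite scale0r subr0; right.
Qed.

(** A form killing the range of [g - a] satisfies [T o g = a T]. *)
Lemma dual_map_eigenvalue {K : fieldType} {V : lmodType K}
    {g : {linear V -> V}} {a : K} (psi : V) :
  (forall phi, g phi - a *: phi <> psi) -> is_eigenvalue (dual_map g) a.
Proof.
move=> Npsi.
have [|||T Tpsi T0] :=
    dual_annihilator (range (fun phi => g phi - a *: phi)) psi.
- by exists 0 => //; rewrite linear0 scaler0 subrr.
- move=> b _ _ [u _ <-] [v _ <-]; exists (b *: u + v) => //.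
  rewrite linearP /= scalerDr scalerBr opprD addrACA !scalerA.
  by rewrite [a * b]mulrC.
- by move=> [phi _ /Npsi].
exists T.
  apply/eqP => T_eq0; move: Tpsi; rewrite T_eq0 => /esym/eqP.
  by rewrite oner_eq0.
apply/val_inj/funext => phi /=.
have := T0 _ (imageT _ phi); rewrite -scaleNr addrC dual_linear => /eqP.
by rewrite scaleNr addrC subr_eq0 => /eqP.
Qed.

(** * Driven linear recurrences with finitely many values *)

Lemma injective_seq_infinite {T : Type} (u : nat -> T) :
  injective u -> ~ finite_set (range u).
Proof.
move=> uI /(finite_preimage (in2W uI)).
have -> : u @^-1` range u = setT by apply/seteqP; split=> // n _; exists n.
exact: infinite_nat.
Qed.

Lemma exprn_unbounded {R : realType} {x : R} (B : R) :
  1 < x -> exists n, B < x ^+ n.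
Proof.
move=> x1; pose n := Num.bound `|B / (x - 1)|; exists n.
have Bern m : 1 + m%:R * (x - 1) <= x ^+ m.
  elim: m => [|m IH]; first by rewrite mul0r addr0 expr0.
  rewrite exprS -natr1.
  apply: (@le_trans _ _ (x * (1 + m%:R * (x - 1)))); last first.
    by rewrite ler_pM2l //; lra.
  have : 0 <= m%:R * (x - 1) ^+ 2 by rewrite mulr_ge0 ?sqr_ge0.
  by rewrite expr2; lra.
apply: lt_le_trans (Bern n).
apply: (@lt_trans _ _ (n%:R * (x - 1))); last by lra.
rewrite -ltr_pdivrMr ?subr_gt0 //; apply: le_lt_trans (ler_norm _) _.
exact: archi_boundP.
Qed.

(** In [d (k + 1) = mu d k + e k] with [|mu| > 1], finiteness of the set of
    values forbids both geometric decay in the past and escape to infinity in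
    the future. *)
Section driven_recurrence.
Context {R : realType} {mu : R[i]} {d e : int -> R[i]}.
Hypothesis fin_d : finite_set (range d).
Hypothesis mu_gt1 : 1 < Normc.normc mu.
Hypothesis rec_d : forall k : int, d (k + 1) = mu * d k + e k.

Let norm (z : R[i]) := Normc.normc z.

Let normD x y : norm (x + y) <= norm x + norm y := le_normcD x y.
Let normM x y : norm (x * y) = norm x * norm y := Normc.normcM x y.
Let norm_ge0 z : 0 <= norm z. Proof. by case: z => *; exact: sqrtr_ge0. Qed.
Let normN x : norm (- x) = norm x := normcN x.

Lemma driven_no_growth (h : R[i] -> R) (g : nat -> int) :
  ~ (forall n, h (d (g n)) < h (d (g n.+1))).
Proof.
move=> hg; have hlt m n : (m < n)%N -> h (d (g m)) < h (d (g n)).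
  exact: (@homo_ltn R (fun n => h (d (g n))) (fun a b => a < b)
    (fun y x z => @lt_trans _ _ y x z) hg m n).
apply: (injective_seq_infinite (d \o g)).
  by move=> m n /= dmn; case: (ltngtP m n) => // /hlt; rewrite dmn ltxx.
by apply: sub_finite_set fin_d => _ [n _ <-]; exists (g n).
Qed.

(** Above the fixed point of [r = |mu| r - 1] the term [mu d k] dominates the
    drive, and [|d|] would increase forever. *)
Lemma driven_bounded k : (forall k : int, norm (e k) <= 1) ->
  norm (d k) <= (norm mu - 1)^-1.
Proof.
move=> e1; rewrite leNgt; apply/negP => dk.
have step j : (norm mu - 1)^-1 < norm (d j) -> norm (d j) < norm (d (j + 1)).
  rewrite -div1r ltr_pdivrMr ?subr_gt0 // => dj.
  have := normD (d (j + 1)) (- e j); rewrite rec_d addrK normM normN.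
  by have := e1 j; lra.
apply: (@driven_no_growth norm (fun n => k + n%:Z)) => n.
rewrite -addn1 PoszD addrA; apply: (step _).
elim: n => [|n IH]; first by rewrite addr0.
by apply: (lt_trans IH); rewrite -addn1 PoszD addrA; apply: (step _).
Qed.

(** Without drive at negative times, [d] decays geometrically in the past, hence
    takes infinitely many values unless it vanishes. *)
Lemma driven_eq0 : (forall k : int, k < 0 -> e k = 0) -> d 0 = 0.
Proof.
move=> e0; apply: contrapT => /eqP d0.
have rec_neg n : d (- n%:Z) = mu * d (- n.+1%:Z).
  by have := rec_d (- n.+1%:Z); rewrite e0 // addr0 => <-; congr (d _); lia.
have dn0 n : d (- n%:Z) != 0.
  elim: n => [|n]; first by rewrite oppr0.
  by rewrite rec_neg mulf_eq0 negb_or => /andP[].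
apply: (@driven_no_growth (fun z => - norm z) (fun n => - n%:Z)) => n.
rewrite ltrN2 [X in _ < norm X]rec_neg normM ltr_pMl //.
rewrite lt_neqAle norm_ge0 andbT eq_sym.
by apply: contra (dn0 n.+1) => /eqP/Normc.eq0_normc ->.
Qed.

(** An isolated unit impulse at time 0 pushes [d] to [mu ^ J] at time [J + 1],
    out of the range of [driven_bounded]. *)
Lemma driven_contradiction J : (forall k : int, norm (e k) <= 1) ->
  (forall k : int, k < 0 -> e k = 0) -> e 0 = 1 ->
  (forall k : int, 0 < k < J.+1%:Z -> e k = 0) ->
  (norm mu - 1)^-1 < norm mu ^+ J ->
  False.
Proof.
move=> e1 eN e0 eJ; have d1 : d 1 = 1.
  by rewrite -[1 in LHS]add0r rec_d driven_eq0 // mulr0 e0 add0r.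
suff dJ : d J.+1%:Z = mu ^+ J.
  have := driven_bounded J.+1%:Z e1; rewrite dJ.
  have -> : norm (mu ^+ J) = norm mu ^+ J.
    elim: (J) => [|j IH]; first by rewrite !expr0; exact: Normc.normc1.
    by rewrite !exprS normM IH.
  by rewrite leNgt => /negP.
elim: {-2}J (leqnn J) => [|j IH] jJ; first by rewrite expr0.
by rewrite -addn1 PoszD rec_d IH 1?ltnW // eJ ?addr0 ?exprS // ; lia.
Qed.
End driven_recurrence.

(** * A word that is slow to recur *)

(** The words tested are suffixes of the past of a sequence [w], so that a longer
    and more selective word is obtained by increasing [N] alone. *)
Definition ends_with {A : Type} (N : nat) (w z : int -> A) (k : int) : Prop :=
  forall i : nat, (i <= N)%N -> z (k - i%:Z) = w (- i%:Z).

(** A word that comes back [k] steps later overlaps itself, which makes its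
    beginning [k]-periodic.  If the common past of [s] and [t] is not
    periodic, no long word ending at 0 recurs soon.  If it has period [m], then
    one of the two sequences, say [s], breaks the period at 0: a long word
    ending there has period [m] except at its last letter, so it cannot recur in [s]
    while it still covers the break and a full period before it; and [t] can be
    replaced by a delayed copy of [s], in which the same break happens only
    after time [J]. *)
Lemma non_recurrent_word {A : Type} (C : set (int -> A)) (s t : int -> A)
    (J : nat) :
  (forall z (j : int), C z -> C (fun k => z (k + j))) -> C s -> C t ->
  (forall k : int, k < 0 -> s k = t k) -> s 0 <> t 0 ->
  exists s' t' (N : nat), [/\ C s', C t',
    forall k : int, k < 0 -> s' k = t' k, s' 0 <> t' 0 &
    forall k : int, 0 < k < J.+1%:Z ->
      ~ ends_with N s' s' k /\ ~ ends_with N s' t' k].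
Proof.
move=> Cshift Cs Ct st st0.
have [[m [m0 per]]|aper] := pselect (exists m : nat,
    (0 < m)%N /\ forall k : int, k < 0 -> s k = s (k - m%:Z)).
  wlog sm : s t Cs Ct st st0 per / s 0 <> s (- m%:Z) => [wl|].
    have [sm|] := pselect (s 0 = s (- m%:Z)); last exact: wl Cs Ct st st0 per.
    apply: (wl t s) => //; [by move=> k /st|by move=> /esym| |].
      by move=> k k0; rewrite -!st //; [exact: per|lia].
    by rewrite -(st (- m%:Z)); [rewrite -sm => /esym|lia].
  have perM j (k : int) : k < 0 -> s (k - (j * m)%N%:Z) = s k.
    elim: j => [|j IH] k0; first by rewrite mul0n subr0.
    rewrite mulSn; move: (j * m)%N (IH k0) => p <-.
    rewrite [RHS]per; last by lia.
    by congr (s _); lia.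
  (* The delay is a multiple of the period, so that both pasts agree, and is
     larger than [J]. *)
  pose P := (J.+1 * m)%N; have JP : (J < P)%N by rewrite /P leq_pmulr.
  exists s, (fun k => s (k - P%:Z)), (P + m)%N; split => //.
  - exact: Cshift.
  - by move=> k k0; rewrite perM.
  - rewrite sub0r /P mulSn PoszD opprD.
    by rewrite perM //; lia.
  - move=> k kJ; split=> [occ|occ].
      have kP : (`|k| + m <= P + m)%N by lia.
      have := occ `|k|%N (leq_trans (leq_addr _ _) kP); have := occ _ kP.
      have -> : k - (`|k| + m)%N%:Z = - m%:Z by lia.
      have -> : k - `|k|%N%:Z = 0 by lia.
      have -> : - (`|k| + m)%N%:Z = - `|k|%N%:Z - m%:Z by lia.
      by rewrite -per => [sm' s0|]; [apply: sm; rewrite s0|lia].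
    apply: sm; rewrite -(occ m) ?leq_addl // -[X in s X]oppr0 -(occ 0%N) //.
    by rewrite subr0 per; [congr (s _); lia|lia].
(* One length [N] that witnesses the failure of all periods up to [J]. *)
have [N aperN] : exists N : nat, forall m : nat, (0 < m <= J)%N ->
    exists2 k : int, - N%:Z <= k - m%:Z & k < 0 /\ s k <> s (k - m%:Z).
  elim: (J) => [|j [N IH]]; first by exists 0%N => m; lia.
  have [k [k0 sk]] : exists k : int, k < 0 /\ s k <> s (k - j.+1%:Z).
    apply: contrapT => Nk; apply: aper; exists j.+1; split=> // k k0.
    by apply: contrapT => sk; apply: Nk; exists k.
  exists (N + `|k - j.+1%:Z|)%N => m /andP[m0].
  rewrite leq_eqVlt => /orP[/eqP ->|mj]; first by exists k => //; lia.
  by have [|l lN ?] := IH m; [rewrite m0|exists l => //; lia].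
have Nocc z (k : int) : (forall k : int, k < 0 -> z k = s k) ->
    0 < k < J.+1%:Z -> ~ ends_with N s z k.
  move=> zs kJ occ; have [|j jN [j0]] := aperN `|k|%N; first by lia.
  apply; rewrite -zs //; have := occ `|k - j|%N.
  have -> : k - `|k - j|%N%:Z = j by lia.
  by move=> ->; [congr (s _); lia|lia].
by exists s, t, N; split=> // k kJ; split; apply: Nocc => // l /st.
Qed.

(** * Branching of itineraries *)

Section itinerary_complexity.
Context {X : choiceType} {A : finType}.

Definition unbounded_complexity (f : X -> X) (alpha : X -> A) : Prop :=
  forall C : nat, exists (K : nat) (F : {fset X}), (C < #|` F|)%N /\
    {in F &, forall x y,
      (forall i, (i < K)%N -> alpha (iter i f x) = alpha (iter i f y)) ->
      x = y}.

Context {f : X -> X} {alpha : X -> A}.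
Hypothesis cplx : unbounded_complexity f alpha.

(** Pigeonhole: two windows of fixed length [n] carry boundedly many codes,
    wherever the second window is placed. *)
Lemma indistinguishable_pair n : exists (K : nat) (x y : X),
  [/\ exists2 i, (i < K)%N & alpha (iter i f x) <> alpha (iter i f y),
      forall i, (i < n)%N -> alpha (iter i f x) = alpha (iter i f y) &
      forall i, (i < n)%N ->
        alpha (iter (K + i) f x) = alpha (iter (K + i) f y)].
Proof.
have [K [F [cardF FK]]] := cplx #|{ffun 'I_n -> A * A}|.
pose g (x : F) := [ffun i : 'I_n =>
  (alpha (iter i f (val x)), alpha (iter (K + i) f (val x)))].
have /injectivePn[x [y xy gxy]] : ~~ injectiveb g.
  by apply/injectiveP => /leq_card; rewrite leqNgt -cardfE cardF.
have gxyi i (ltin : (i < n)%N) :=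
  congr1 (fun h : {ffun _ -> _} => h (Ordinal ltin)) gxy.
exists K, (val x), (val y); split=> [|i iN|i iN];
  try by have := gxyi i iN; rewrite !ffunE => -[].
apply: contrapT => NK; move/eqP: xy; apply; apply/val_inj/FK;
  rewrite ?fsvalP //.
by move=> i iK; apply: contrapT => Ni; apply: NK; exists i.
Qed.

(** Otherwise the letters of the window [[n, 2n)] determine the next one, and
    inductively the whole future, against [indistinguishable_pair]. *)
Lemma forward_branching n : exists x y : X,
  alpha (iter (2 * n) f x) <> alpha (iter (2 * n) f y) /\
  forall k, (n <= k < 2 * n)%N -> alpha (iter k f x) = alpha (iter k f y).
Proof.
have [K [x [y [[i _ Ni] xy _]]]] := indistinguishable_pair (2 * n).
apply: contrapT => Nb; apply: Ni; elim/ltn_ind: i => i IH.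
case: (ltnP i (2 * n)) => [/xy//|ni]; apply: contrapT => Ni; apply: Nb.
exists (iter (i - 2 * n) f x), (iter (i - 2 * n) f y).
rewrite -!iterD subnKC //; split=> // k kn; rewrite -!iterD; apply: IH; lia.
Qed.

(** Otherwise, at all times [>= n], a window of length [n] determines the letter
    before it.  Points that agree on the windows of length [n + 1] at 0 and at
    [K] then agree in between. *)
Lemma backward_branching n : exists x y : X,
  alpha (iter n f x) <> alpha (iter n f y) /\
  forall k, (n < k <= 2 * n)%N -> alpha (iter k f x) = alpha (iter k f y).
Proof.
have [K [x [y [[i iK Ni] xy xyK]]]] := indistinguishable_pair n.+1.
apply: contrapT => Nb; apply: Ni; case: (ltnP i n.+1) => [/xy//|ni].
move: ni iK; have [j Kij] := ubnP (K - i); elim: j => // j IH in i Kij *.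
move=> ni iK; apply: contrapT => Ni; apply: Nb.
exists (iter (i - n) f x), (iter (i - n) f y).
rewrite -!iterD subnKC ?(ltnW ni) //; split=> // k kn; rewrite -!iterD.
have [Kk|kK] := leqP K (k + (i - n)); last by apply: IH; lia.
by rewrite -(subnKC Kk); apply: xyK; lia.
Qed.
End itinerary_complexity.

(** * Full orbits as limits *)

Definition full_orbit {X : Type} (f : X -> X) (x : int -> X) : Prop :=
  forall k, f (x k) = x (k + 1).

(** An ultrafilter decides whether [g] eventually lies in a given neighbourhood;
    at a cluster point of the image the negative answer is impossible. *)
Lemma ultra_cvg_compact {T : Type} {X : topologicalType} (U : set_system T)
    (g : T -> X) :
  UltraFilter U -> compact [set: X] -> exists x : X, g t @[t --> U] --> x.
Proof.
move=> UU compactX.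
have [x [_ clx]] := compactX (g t @[t --> U]) _ filterT; exists x => B /= nB.
have [//|NB] := in_ultra_setVsetC (g @^-1` B) UU.
by have [y [/= NBy By]] := clx (~` B) B NB nB.
Qed.

(** Along an ultrafilter, the orbits of [p n] and [q n], with time origin moved
    to [c n], converge at every integer time.  Since [c n] tends to infinity,
    the limits extend indefinitely into the past, and local constancy transfers
    to them every relation between codes that holds eventually. *)
Lemma asymptotic_orbits {X : topologicalType} {A : Type} {f : X -> X}
    {alpha : X -> A} (p q : nat -> X) {c : nat -> nat} :
  compact [set: X] -> hausdorff_space X -> continuous f ->
  (forall x, \forall y \near x, alpha y = alpha x) ->
  (forall n, (n <= c n)%N) ->
  exists x y : int -> X, [/\ full_orbit f x, full_orbit f y &
    forall (r : A -> A -> Prop) (k : int),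
      (\forall n \near \oo, r (alpha (iter `|(c n)%:Z + k| f (p n)))
                              (alpha (iter `|(c n)%:Z + k| f (q n)))) ->
      r (alpha (x k)) (alpha (y k))].
Proof.
move=> compactX hausX cf lc cn.
have [U [UU sU]] := @ultraFilterLemma nat \oo _.
have lim (u : nat -> X) : exists x : int -> X, full_orbit f x /\
    forall k, iter `|(c n)%:Z + k| f (u n) @[n --> U] --> x k.
  have /choice[x xP] k := ultra_cvg_compact U
    (fun n => iter `|(c n)%:Z + k| f (u n)) UU compactX.
  exists x; split=> // k.
  apply: (@cvg_unique _ hausX
    (iter `|(c n)%:Z + (k + 1)| f (u n) @[n --> U])) => //;
    last exact: (xP (k + 1)).
  apply: cvg_trans (cvg_comp _ _ (xP k) (cf (x k))).
  apply: near_eq_cvg; apply: sU; exists `|k|%N => // n /= kn.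
  by rewrite -iterS; congr (iter _ f (u n)); have := cn n; lia.
have [x [ox xP]] := lim p; have [y [oy yP]] := lim q.
exists x, y; split=> // r k /sU rU.
have Ux : \forall n \near U, alpha (iter `|(c n)%:Z + k| f (p n)) = alpha (x k).
  exact: xP k _ (lc (x k)).
have Uy : \forall n \near U, alpha (iter `|(c n)%:Z + k| f (q n)) = alpha (y k).
  exact: yP k _ (lc (y k)).
by have [n [[<- <-]]] := filter_ex (filterI (filterI Ux Uy) rU).
Qed.

(** * Locally constant functions and clopen sets in compact spaces *)

Lemma compact_finite_cover {X : topologicalType} (D : X -> set X) :
  compact [set: X] -> (forall x, nbhs x (D x)) ->
  exists s : seq X, forall y, exists2 x, x \in s & D x y.
Proof.
move=> /compact_near_coveringP covX nD.
pose F := filter_from [set: seq X]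
  (fun s0 => [set s : seq X | {subset s0 <= s}]).
have FF : ProperFilter F.
  apply: filter_from_proper => [|s _]; last by exists s => /=.
  apply: filter_from_filter => [|s1 s2 _ _]; first by exists [::].
  by exists (s1 ++ s2) => // s /= sub; split=> x xs; apply: sub;
    rewrite mem_cat xs ?orbT.
have [x _|s sP] := filter_ex (covX _ F
    (fun (s : seq X) y => exists2 x, x \in s & D x y) _ _).
  exists (D x, [set s : seq X | x \in s]) => [|[y s] [/= Dy xs]];
    last by exists x.
  by split=> //=; exists [:: x] => // s; apply; rewrite mem_head.
by exists s => y; apply: sP.
Qed.

Lemma locally_constant_finite_range {X : topologicalType} {K : fieldType}
  {phi : X -> K^o} : compact [set: X] -> locally_constant phi ->
  finite_set (range phi).
Proof.
move=> compactX lc.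
have [s sP] := compact_finite_cover (fun x y => phi y = phi x) compactX lc.
apply: (@sub_finite_set _ _ [set` map phi s]); last exact: finite_seq.
by move=> _ [y _ <-] /=; have [x xs ->] := sP y; apply: map_f.
Qed.

(** The clopen sets containing [x] are stable under intersection; if none of
    them lay in [W], their traces on the compact set [~` W] would cluster at a
    point of their intersection. *)
Lemma clopen_in_quasi_nbhs {X : topologicalType} (x : X) (W : set X) :
  compact [set: X] -> open W ->
  \bigcap_(D in [set D : set X | D x /\ clopen D]) D `<=` W ->
  exists D : set X, [/\ D x, clopen D & D `<=` W].
Proof.
move=> compactX oW QW; pose B := [set D : set X | D x /\ clopen D].
have BI D E : B D -> B E -> B (D `&` E).
  by move=> [? ?] [? ?]; split=> //; exact: clopenI.
have compactWC : compact (~` W).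
  by apply: (subclosed_compact _ compactX) => //; exact: open_closedC.
apply: contrapT => NW.
have BT : B setT by split=> //; exact: clopenT.
pose F := filter_from B (fun D => D `\` W).
have FF : ProperFilter F.
  apply: filter_from_proper => [|D [Dx cD]].
    apply: filter_from_filter; first by exists setT.
    move=> D E BD BE.
    by exists (D `&` E); [exact: BI|move=> y [[? ?] ?]; split].
  apply: contrapT => /set0P/negP; rewrite negbK => /eqP DW0; apply: NW.
  exists D; split=> // y Dy; apply: contrapT => NWy.
  by have : (D `\` W) y by []; rewrite DW0.
have [y [NWy cly]] : (~` W) `&` cluster F !=set0.
  by apply: compactWC; exists setT => // y [].
apply: NWy; apply: QW => D [Dx [oD cD]]; apply: (cD) => C nC.
have [|z [[Dz _] Cz]] := cly (D `\` W) C _ nC; first by exists D.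
by exists z.
Qed.

(** In a compact Hausdorff space quasi-components are connected: if the
    quasi-component splits into two closed pieces, normality separates them, and
    a clopen neighbourhood of [x] inside the separating open sets can be cut
    down to the piece of [x]. *)
Lemma quasi_component_connected {X : topologicalType} (x : X) :
  compact [set: X] -> hausdorff_space X ->
  connected (\bigcap_(D in [set D : set X | D x /\ clopen D]) D).
Proof.
move=> compactX hausX; set Q := \bigcap_(D in _) D.
have cQ : closed Q by apply: closed_bigI => D [_ []].
have Qx : Q x by move=> D [].
apply: contrapT => /connectedPn[E0 [E0n0 QE0 sepE0]].
have [E [E1n0 QE sepE Ex]] : exists E : bool -> set X,
    [/\ E true !=set0, Q = E false `|` E true,
        separated (E false) (E true) & E false x].
  have := Qx; rewrite {1}QE0 => -[|] Ex; first by exists E0.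
  by exists (E0 \o negb); split=> //=; [rewrite QE0 setUC|rewrite separatedC].
have [sep1 sep2] := sepE; have clE : closed (E false).
  move=> y cly; have : Q y.
    by apply: cQ; apply: closureS cly; rewrite QE; exact: subsetUl.
  by rewrite QE => -[//|Ety]; have : set0 y by rewrite -sep1.
have [|V /set_nbhsP[U [oU EU UV]] clV] :=
    compact_normal hausX compactX clE (t := ~` closure (E true)).
  apply/set_nbhsP; exists (~` closure (E true)); split=> //.
    exact/closed_openC/closed_closure.
  by move=> y Efy clEty; have : set0 y by rewrite -sep2.
have [|y|D [Dx [oD cD] DW]] :=
    clopen_in_quasi_nbhs x (U `|` ~` closure V) compactX.
- by apply: openU => //; exact/closed_openC/closed_closure.
- rewrite -/Q QE => -[/EU|Ety]; [by left|right => /clV].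
  by apply; exact: subset_closure.
have UclV : U `<=` closure V by apply: subset_trans UV _; exact: subset_closure.
have DU : D `&` U = D `&` closure V.
  apply/seteqP; split=> y [Dy Uy]; split=> //; first exact: UclV.
  by have [] := DW y Dy.
have [y Ety] := E1n0; have Qy : Q y by rewrite QE; right.
have [|_ /UclV/clV] := Qy (D `&` U); last by apply; exact: subset_closure.
split; first by split=> //; exact: EU.
split; first exact: openI.
by rewrite DU; apply: closedI => //; exact: closed_closure.
Qed.

Lemma totally_disconnected_zero_dimensional {X : topologicalType} :
  compact [set: X] -> hausdorff_space X -> totally_disconnected [set: X] ->
  zero_dimensional X.
Proof.
move=> compactX hausX td x y xy; apply: contrapT => NU; move/eqP: xy; apply.
have : connected_component [set: X] x y; last by rewrite td.
exists (\bigcap_(D in [set D : set X | D x /\ clopen D]) D).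
  by split=> //; [move=> D []|exact: quasi_component_connected].
by move=> D [Dx cD]; apply: contrapT => NDy; apply: NU; exists D.
Qed.

(** The code of a point is the set of members of a finite cover by small clopen
    sets to which it belongs. *)
Lemma fine_clopen_coding {R : realType} {X : metricType R} {eps : R} :
  compact [set: X] -> totally_disconnected [set: X] -> 0 < eps ->
  exists (A : finType) (alpha : X -> A),
    (forall x, \forall y \near x, alpha y = alpha x) /\
    forall x y, alpha x = alpha y -> mdist x y <= eps.
Proof.
move=> compactX td eps0.
have zdX := totally_disconnected_zero_dimensional compactX
  (@metric_hausdorff R X) td.
have /choice[D DP] x : exists D : set X,
    [/\ D x, clopen D & D `<=` ball x (eps / 2)].
  have [|D [Dx cD] sD] := @zero_dimensional_cvg X x (@metric_hausdorff R X) zdX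
    compactX (ball x (eps / 2)); last by exists D.
  by apply: nbhsx_ballx; rewrite divr_gt0.
have [|s sP] := compact_finite_cover D compactX.
  by move=> x; have [Dx [oD _] _] := DP x; exact: open_nbhs_nbhs.
pose U (i : 'I_(size s)) := D (tnth (in_tuple s) i).
exists {set 'I_(size s)}, (fun x => [set i | `[< U i x >]]%SET).
split=> [x|x y exy].
  have : \forall y \near x, forall i, U i y = U i x.
    apply: filter_forall => i; have [_ [oD cD] _] := DP (tnth (in_tuple s) i).
    have [Dx|NDx] := pselect (U i x).
      by apply: filterS (open_nbhs_nbhs (conj oD Dx)) => y Dy; apply/propext.
    have := open_nbhs_nbhs (conj (closed_openC cD) NDx).
    by apply: filterS => y NDy; apply/propext.
  by apply: filterS => y yx; apply/setP => i; rewrite !inE yx.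
have [z /(nthP z)[i isz zi] Dx] := sP x.
have Dy : D z y.
  have /setP/(_ (Ordinal isz)) := exy.
  by rewrite !inE /U (tnth_nth z) /= zi (asboolT Dx) => /esym/asboolP.
have [_ _ sD] := DP z; apply: le_trans (metric_triangle x z y) _.
have := sD x Dx; have := sD y Dy; rewrite ballEmdist /= (metric_sym x z); lra.
Qed.

(** * Entropy, expansiveness and complexity *)

Section complexity_criteria.
Context {R : realType} {X : metricType R} {A : finType}.
Context {f : X -> X} {alpha : X -> A} {eps : R}.
Hypothesis alpha_fine : forall x y, alpha x = alpha y -> mdist x y <= eps.

Lemma expansive_unbounded :
  (forall x y, x <> y -> exists n, eps < mdist (iter n f x) (iter n f y)) ->
  infinite_set [set: X] -> unbounded_complexity f alpha.
Proof.
move=> expf infX C.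
have [F _ cardF] := infinite_set_fset C.+1 infX.
have /choice[N NP] (xy : X * X) : exists n,
    xy.1 <> xy.2 -> eps < mdist (iter n f xy.1) (iter n f xy.2).
  have [->|/eqP ne] := eqVneq xy.1 xy.2; first by exists 0%N.
  by have [n ?] := expf _ _ ne; exists n.
pose K := \max_(x : F) \max_(y : F) N (val x, val y).
exists K.+1, F; split=> // x y xF yF exy; apply: contrapT => /(NP (x, y)) /=.
apply/negP; rewrite -leNgt; apply/alpha_fine/exy; rewrite ltnS.
apply: leq_trans (leq_bigmax (F := fun x : F => \max_(y : F) N (val x, val y))
  [` xF]%fset).
exact: (leq_bigmax (F := fun y : F => N (x, val y)) [` yF]%fset).
Qed.

(** A strict Bowen distance above [eps] is attained at some time, when the codes
    have to differ. *)
Lemma separated_word_distinct n (F : {fset X}) :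
  0 <= eps -> Defs.separated f n eps F ->
  {in F &, forall x y,
    (forall i, (i < n)%N -> alpha (iter i f x) = alpha (iter i f y)) -> x = y}.
Proof.
move=> eps0 sepF x y xF yF exy; apply/eqP.
apply: contraPT exy => /(sepF _ _ xF yF) lt_eps exy; move: lt_eps.
apply/negP; rewrite -leNgt.
by apply/bigmax_leP; split=> // i _; apply/alpha_fine/exy.
Qed.

(** If the number of code words were bounded, so would be the cardinality of all
    [(n, eps)]-separated sets, and dividing its logarithm by [n] gives 0 in the
    limit. *)
Lemma entropy_unbounded : 0 <= eps -> sep_growth f eps <> 0%E ->
  unbounded_complexity f alpha.
Proof.
move=> eps0 growth C; apply: contrapT => NC; apply: growth.
have card_le n (F : {fset X}) : Defs.separated f n eps F -> (#|` F| <= C)%N.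
  move=> sepF; rewrite leqNgt; apply/negP => ltC; apply: NC; exists n, F.
  by split=> //; exact: separated_word_distinct.
have sep_le n : (log_sep f n eps <= (ln C.+1%:R)%:E)%E.
  apply/ereal_supP => _ [F sepF <-]; rewrite lee_fin.
  have [->|F0] := eqVneq #|` F| 0%N; first by rewrite ln0 // ln_ge0 // ler1n.
  rewrite ler_ln ?posrE ?ltr0n ?lt0n // ler_nat.
  exact: leq_trans (card_le _ _ sepF) _.
have sep_ge n : (0 <= log_sep f n eps)%E.
  apply: ereal_sup_ubound; exists fset0; first by move=> x y; rewrite inE.
  by rewrite cardfs0 ln0.
suff : ((n%:R^-1 : R)%:E * log_sep f n eps)%E @[n --> \oo] --> 0%E.
  move=> c0; rewrite /sep_growth is_cvg_limn_esupE; first exact/cvg_lim.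
  by apply/cvg_ex; exists 0%E.
apply: (squeeze_cvge (f := cst 0%E) (h := fun n => (n%:R^-1 * ln C.+1%:R)%:E)).
- apply: nearW => n; rewrite mule_ge0 ?lee_fin ?invr_ge0 //=.
  by rewrite EFinM lee_wpmul2l ?lee_fin ?invr_ge0.
- exact: cvg_cst.
apply/cvg_EFin; first by apply: nearW.
rewrite -[0](mul0r (ln C.+1%:R)); apply: cvgM; last exact: cvg_cst.
by rewrite -cvg_shiftS; exact: cvg_harmonic.
Qed.

End complexity_criteria.

Lemma sep_growth_neq0 {R : realType} {X : metricType R} (f : X -> X) :
  topological_entropy f <> 0%E ->
  exists2 eps : R, 0 < eps & sep_growth f eps <> 0%E.
Proof.
move=> ent; apply: contrapT => N; apply: ent; apply: lim_near_cst => //.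
near=> e; apply: contrapT => ne0; apply: N; exists e => //; near: e.
Unshelve. all: by end_near. Qed.

(** * Locally constant functions outside the range of f^* - lambda *)

(** The drive is the difference of the occurrences of one word of [s] in [s] and
    in [t]; as these sequences have the same past and the word is slow to recur,
    it is an isolated unit impulse at time 0. *)
Lemma word_difference_not_driven {R : realType} {A : Type} {mu : R[i]}
    {d : int -> R[i]} {s t : int -> A} {N J : nat} :
  finite_set (range d) -> 1 < Normc.normc mu ->
  (Normc.normc mu - 1)^-1 < Normc.normc mu ^+ J ->
  (forall k : int, k < 0 -> s k = t k) -> s 0 <> t 0 ->
  (forall k : int, 0 < k < J.+1%:Z ->
    ~ ends_with N s s k /\ ~ ends_with N s t k) ->
  ~ (forall k : int, d (k + 1) = mu * d k +
      (`[< ends_with N s s k >]%:R - `[< ends_with N s t k >]%:R)).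
Proof.
move=> fin_d mu1 muJ st st0 nrec rec.
apply: (driven_contradiction fin_d mu1 rec J) => // [k|k k0||k kJ].
- case: asbool; case: asbool; rewrite ?subrr ?subr0 ?sub0r ?le_normcN.
  + by rewrite Normc.normc0.
  + by rewrite Normc.normc1.
  + by rewrite normcN Normc.normc1.
  + by rewrite Normc.normc0.
- rewrite [X in X - _](_ : _ = `[< ends_with N s t k >]%:R) ?subrr //.
  congr (nat_of_bool _)%:R; apply/asbool_equiv_eq; split=> occ i iN.
    by rewrite -st ?occ //; lia.
  by rewrite st ?occ //; lia.
- rewrite asboolT ?asboolF ?subr0 // => [/(_ 0%N isT)|i _];
    last by rewrite sub0r.
  by rewrite subr0 oppr0 => /esym.
- by have [Ns Nt] := nrec k kJ; rewrite !asboolF // subrr.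
Qed.

Section coboundary_obstruction.
Context {R : realType} {X : topologicalType} {A : finType}.
Context {f : X -> X} {alpha : X -> A}.
Hypotheses (compactX : compact [set: X]) (hausX : hausdorff_space X).
Hypotheses (cf : continuous f)
  (lc : forall x, \forall y \near x, alpha y = alpha x).

Definition word_indicator (N : nat) (w : nat -> A) (x : X) : R[i]^o :=
  `[< forall i : nat, (i <= N)%N -> alpha (iter i f x) = w i >]%:R.

Lemma word_indicator_locally_constant N w :
  locally_constant (word_indicator N w).
Proof.
move=> x; have : \forall y \near x, forall i : 'I_N.+1,
    alpha (iter i f y) = alpha (iter i f x).
  apply: filter_forall => i; have ci : continuous (iter i f).
    elim: (nat_of_ord i) => [|n IH] y; first exact: cvg_id.
    by apply: (@continuous_comp _ _ _ (iter n f) f); [exact: IH|exact: cf].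
  exact: ci x _ (lc _).
apply: filterS => y exy; congr (nat_of_bool _)%:R; apply/asbool_equiv_eq.
by split=> wi i iN; rewrite -wi //;
  have /= := exy (Ordinal (iN : (i < N.+1)%N)).
Qed.

Lemma full_orbit_iter x : full_orbit f x ->
  forall (i : nat) (k : int), iter i f (x k) = x (k + i%:Z).
Proof.
move=> ox; elim=> [|i IH] k; first by rewrite addr0.
by rewrite iterS IH ox; congr x; lia.
Qed.

Lemma full_orbit_shift x j :
  full_orbit f x -> full_orbit f (fun k => x (k + j)).
Proof. by move=> ox k; rewrite ox; congr x; lia. Qed.

Hypothesis cplx : unbounded_complexity f alpha.

(** The differences of a solution [phi] along two asymptotic orbits form a
    driven recurrence: forwards, with multiplier [lambda], if [|lambda| > 1],
    and backwards, with multiplier [lambda^-1], if [|lambda| < 1]. *)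
Lemma coboundary_obstruction {lambda : R[i]} :
  lambda != 0 -> Normc.normc lambda != 1 ->
  exists psi : X -> R[i]^o, locally_constant psi /\
    forall phi : X -> R[i]^o, locally_constant phi ->
      ~ (forall x, phi (f x) = lambda * phi x + psi x).
Proof.
move=> l0; have [l1 _|l1 _|//] := ltgtP (Normc.normc lambda) 1.
- have nl0 : 0 < Normc.normc lambda.
    rewrite lt_neqAle; apply/andP; split;
      last by case: (lambda) => *; exact: sqrtr_ge0.
    by apply: contra l0 => /eqP/esym/Normc.eq0_normc ->.
  have mu1 : 1 < Normc.normc lambda^-1 by rewrite Normc.normcV invf_gt1.
  have [J muJ] := exprn_unbounded (Normc.normc lambda^-1 - 1)^-1 mu1.
  have /choice[p pP] n := backward_branching cplx n.
  have /choice[q qP] n := pP n.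
  have [x [y [ox oy xy]]] :=
    asymptotic_orbits p q (c := id) compactX hausX cf lc leqnn.
  pose C := [set z : int -> A |
    exists2 x, full_orbit f x & z = (fun k => alpha (x (- k)))].
  have [z j [u ou ->]|||k k0||s [t [N [[u ou sE] [v ov tE] st st0 nrec]]]] :=
      non_recurrent_word C (fun k => alpha (x (- k)))
        (fun k => alpha (y (- k))) J.
  + exists (fun k => u (k - j)); first exact: full_orbit_shift.
    by apply/funext => k; congr (alpha (u _)); lia.
  + by exists x.
  + by exists y.
  + apply: (xy (fun a b => a = b)); exists `|k|%N => // n /= kn.
    by apply: (qP n).2; lia.
  + rewrite oppr0; apply: (xy (fun a b => a <> b)); apply: nearW => n.
    by have [] := qP n; rewrite addr0.
  exists (word_indicator N (fun i => s (- i%:Z))).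
  split=> [|phi lphi coh]; first exact: word_indicator_locally_constant.
  have fin_phi := locally_constant_finite_range compactX lphi.
  (* Solving for [phi] at the earlier time makes the drive [- lambda^-1] times
     the word difference, hence the factor [- lambda]; the argument [1 - k] aligns
     the drive at [k] with the orbits at time [- k]. *)
  apply: (word_difference_not_driven (mu := lambda^-1)
    (d := fun k => - lambda * (phi (u (1 - k)) - phi (v (1 - k))))
    _ mu1 muJ st st0 nrec).
    apply: sub_finite_set
      (finite_image2 (fun a b => - lambda * (a - b)) fin_phi fin_phi).
    move=> _ [k _ <-].
    by exists (phi (u (1 - k))) => //; exists (phi (v (1 - k))).
  have occE z k : full_orbit f z ->
      word_indicator N (fun i => s (- i%:Z)) (z (- k)) =
      `[< ends_with N s (fun k => alpha (z (- k))) k >]%:R.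
    move=> oz; congr (nat_of_bool _)%:R; apply: asbool_equiv_eq.
    by split=> occ i /occ; rewrite full_orbit_iter // opprB addrC.
  move=> k; rewrite {2}sE tE -(occE u) // -(occE v) //.
  have -> : 1 - (k + 1) = - k :> int by lia.
  have -> : 1 - k = - k + 1 :> int by lia.
  rewrite -!ou -!ov !coh. field.
  exact: l0.
- have [J muJ] := exprn_unbounded (Normc.normc lambda - 1)^-1 l1.
  have /choice[p pP] n := forward_branching cplx n.
  have /choice[q qP] n := pP n.
  have c2 n : (n <= 2 * n)%N by lia.
  have [x [y [ox oy xy]]] := asymptotic_orbits p q compactX hausX cf lc c2.
  pose C := [set z : int -> A | exists2 x, full_orbit f x & z = alpha \o x].
  have [z j [u ou ->]|||k k0||s [t [N [[u ou sE] [v ov tE] st st0 nrec]]]] :=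
      non_recurrent_word C (alpha \o x) (alpha \o y) J.
  + by exists (fun k => u (k + j)); first exact: full_orbit_shift.
  + by exists x.
  + by exists y.
  + apply: (xy (fun a b => a = b)); exists `|k|%N => // n /= kn.
    by apply: (qP n).2; lia.
  + apply: (xy (fun a b => a <> b)); apply: nearW => n.
    by have [] := qP n; rewrite addr0.
  (* The indicator reads forwards from time [k - N] the word that ends at [k]. *)
  exists (word_indicator N (fun i => s (- (N - i)%N%:Z))).
  split=> [|phi lphi coh]; first exact: word_indicator_locally_constant.
  have fin_phi := locally_constant_finite_range compactX lphi.
  apply: (word_difference_not_driven (mu := lambda)
    (d := fun k => phi (u (k - N%:Z)) - phi (v (k - N%:Z)))
    _ l1 muJ st st0 nrec).
    apply: sub_finite_set (finite_image2 (fun a b => a - b) fin_phi fin_phi).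
    move=> _ [k _ <-].
    by exists (phi (u (k - N%:Z))) => //; exists (phi (v (k - N%:Z))).
  have occE z k : full_orbit f z ->
      word_indicator N (fun i => s (- (N - i)%N%:Z)) (z (k - N%:Z)) =
      `[< ends_with N s (alpha \o z) k >]%:R.
    move=> oz; congr (nat_of_bool _)%:R; apply: asbool_equiv_eq.
    split=> occ i iN; have := occ (N - i)%N (leq_subr _ _);
      rewrite /= ?full_orbit_iter //.
      by rewrite subKn // => <-; congr (alpha (z _)); lia.
    by move=> <-; congr (alpha (z _)); lia.
  move=> k; rewrite {2}sE tE -(occE u) // -(occE v) //.
  have -> : k + 1 - N%:Z = k - N%:Z + 1 by lia.
  by rewrite -!ou -!ov !coh; ring.
Qed.

End coboundary_obstruction.

Theorem corollary3 (R : realType) (X : metricType R)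
  (compactX : compact [set: X])
  (totdiscX : totally_disconnected [set: X])
  (f : X -> X) (cf : continuous f)
  (hf : topological_entropy f <> 0%E \/
        (positively_expansive f /\ infinite_set [set: X]))
  (lambda : R[i]) (lambda_neq0 : `|lambda| <> 0) (lambda_neq1 : `|lambda| <> 1) :
  is_eigenvalue (cech_pushforward (K := R[i]) cf) lambda.
Proof.
have [A [alpha [lc cplx]]] : exists (A : finType) (alpha : X -> A),
    (forall x, \forall y \near x, alpha y = alpha x) /\
    unbounded_complexity f alpha.
  case: hf => [/sep_growth_neq0[eps eps0 growth]|[[eps eps0 expf] infX]];
    have [A [alpha [lc fine]]] := fine_clopen_coding compactX totdiscX eps0;
    exists A, alpha; split=> //.
    exact: entropy_unbounded fine (ltW eps0) growth.
  exact: expansive_unbounded fine expf infX.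
have l0 : lambda != 0.
  by apply: contra_notN lambda_neq0 => /eqP ->; rewrite normr0.
have l1 : Normc.normc lambda != 1.
  apply: contra_notN lambda_neq1 => /eqP.
  by case: (lambda) => a b /= nl; rewrite normc_def /= nl.
have [psi [lpsi Npsi]] :=
  coboundary_obstruction compactX (@metric_hausdorff R X) cf lc cplx l0 l1.
apply: (dual_map_eigenvalue (CechH0 (introT (asboolP _) lpsi))).
move=> phi coh; apply: (Npsi phi).
  by have /asboolP := cechH0_funP phi.
move=> x; have := congr1 (fun g : cechH0 R[i] X => g x) coh => /= <-.
by rewrite addrC subrK.
Qed.
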